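(* Let $\mathcal{G}$ be an ultragraph that satisfies Condition (RFUM2), and let $X$ be its boundary ultrapath space. Then each of the basic cylinder sets of $X$, namely each $D_{(\beta,B)}$ with $(\beta,B)\in\mathfrak{p}$, $|\beta|\geq 1$, and each $D_{(\beta,B),F,S}$ with $(\beta,B)\in X_{fin}$, $F\subseteq\varepsilon(B)$ finite and $S\subseteq B\cap G^0_s$ finite, is compact in the topology on $X$ having these cylinders as a basis.
   Context: An ultragraph $\mathcal{G}=(G^0,\mathcal{G}^1,r,s)$ consists of countable sets $G^0$ (vertices) and $\mathcal{G}^1$ (edges) and maps $s:\mathcal{G}^1\to G^0$, $r:\mathcal{G}^1\to P(G^0)\setminus\{\emptyset\}$. $\mathcal{G}^0$ (generalized vertices) is the smallest subset of $P(G^0)$ containing $\{v\}$ for all $v\in G^0$ and $r(e)$ for all $e\in\mathcal{G}^1$, and closed under finite unions and nonempty finite intersections. For $A\in\mathcal{G}^0$, $\varepsilon(A)=\{e\in\mathcal{G}^1:s(e)\in A\}$; $A$ is an infinite emitter if $|\varepsilon(A)|=\infty$ and a finite emitter otherwise. A vertex $v$ is a sink if $s^{-1}(v)=\emptyset$ and regular if $0<|s^{-1}(v)|<\infty$; $G^0_s$ is the set of sinks. $A\in\mathcal{G}^0$ is a minimal infinite emitter if it is an infinite emitter and no proper subset $B\in\mathcal{G}^0$ of $A$ is an infinite emitter or a finite emitter with $|B|=\infty$. $A\in\mathcal{G}^0$ is a minimal sink if $|A|=\infty$, $|\varepsilon(A)|<\infty$ and no proper subset $B\in\mathcal{G}^0$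 of $A$ is infinite. Condition (RFUM2): for each $e\in\mathcal{G}^1$, $r(e)=\bigcup_{n=1}^kA_n$ for finitely many $A_n$, each of which is a minimal infinite emitter, or a minimal sink, or a singleton formed by a sink or a regular vertex. A finite path of length $n\ge1$ is $\alpha=e_1\ldots e_n$ with $e_i\in\mathcal{G}^1$, $s(e_{i+1})\in r(e_i)$; $s(\alpha)=s(e_1)$, $r(\alpha)=r(e_n)$. An ultrapath of length $n\ge 1$ is a pair $(\alpha,A)$ with $\alpha$ a finite path of length $n$, $A\in\mathcal{G}^0$, $A\subseteq r(\alpha)$; an ultrapath of length $0$ is an $A\in\mathcal{G}^0$, also written $(A,A)$, with $s(A)=r(A)=A$. $\mathfrak{p}$ is the set of all ultrapaths; $\mathfrak{p}^\infty$ is the set of infinite paths $e_1e_2\ldots$ with $s(e_{i+1})\in r(e_i)$. $|x|$ denotes length. $X_{fin}$ is the set of ultrapaths $(\alpha,A)$ of length $\geq 0$ (meaning $(A,A)$ for length $0$) such that $A$ is a minimal infinite emitter, or a minimal sink, or $A=\{v\}$ with $v$ a sink; $X_{sin}\subseteq X_{fin}$ consists of those for which $A$ is a minimal sink or $A=\{v\}$ with $v$ a sink. The boundary ultrapath space is $X=\mathfrak{p}^\infty\sqcup X_{fin}$. Cylinders: for $(\beta,B)\in\mathfrak{p}$, $D_{(\beta,B)}=\{y\in X: y=\beta\gamma,\ s(\gamma)\in B\}$, i.e. $\gamma$ runs over infinite paths or ultrapaths starting in $B$, where for $\gamma$ of length $0$ (so $\gamma=(C,C)$, $y=(\beta,C)$)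 the condition reads $C\subseteq B$. For $(\beta,B)\in X_{fin}$, $F\subseteq\varepsilon(B)$ finite and $S\subseteq B\cap G^0_s$ finite, $$D_{(\beta,B),F,S}=\{(\beta,B)\}\cup\{y\in X:y=\beta\gamma',\ |\gamma'|\ge1,\ \gamma'_1\in\varepsilon(B)\setminus F\}\cup\{(\beta,\{v\})\in X_{sin}: v\in B\setminus S\},$$ where $\gamma'_1$ is the first edge of $\gamma'$ (for $|\beta|=0$: $\beta\gamma'=\gamma'$, and $(\beta,\{v\})$ means $(\{v\},\{v\})$). These cylinders form a countable basis for a topology on $X$. *)

(* Defs.v *)
From HB Require Import structures.
From mathcomp Require Import all_boot.
From mathcomp Require Import boolp classical_sets functions cardinality.
From mathcomp Require Import filter topology_structure compact.

Set Implicit Arguments.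
Unset Strict Implicit.
Unset Printing Implicit Defensive.

Local Open Scope classical_set_scope.

Record ultragraph := Ultragraph {
  vertex : countType;
  edge : countType;
  src : edge -> vertex;
  rng : edge -> set vertex;
  rng_nonempty : forall e, rng e !=set0 }.

Arguments src {u} _.
Arguments rng {u} _ _.

Section Ultragraph.
Variable G : ultragraph.
Implicit Types (A B : set (vertex G)) (v : vertex G) (e : edge G).

Inductive gvertex : set (vertex G) -> Prop :=
| gvertex_vertex v : gvertex [set v]
| gvertex_rng e : gvertex (rng e)
| gvertex_union A B : gvertex A -> gvertex B -> gvertex (A `|` B)
| gvertex_inter A B :
    gvertex A -> gvertex B -> A `&` B !=set0 -> gvertex (A `&` B).

Definition emitted A : set (edge G) := [set e | A (src e)].

Definition infinite_emitter A := gvertex A /\ infinite_set (emitted A).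
Definition finite_emitter A := gvertex A /\ finite_set (emitted A).

Definition sink v := src @^-1` [set v] = set0 :> set (edge G).
Definition regular v :=
  (src @^-1` [set v] : set (edge G)) !=set0 /\
  finite_set (src @^-1` [set v] : set (edge G)).

Definition minimal_infinite_emitter A :=
  infinite_emitter A /\
  forall B, gvertex B -> B `<` A ->
    ~ (infinite_emitter B \/ finite_emitter B /\ infinite_set B).

Definition minimal_sink A :=
  [/\ gvertex A, infinite_set A, finite_set (emitted A) &
      forall B, gvertex B -> B `<` A -> ~ infinite_set B].

Definition RFUM2 := forall e,
  exists (k : nat) (A : 'I_k -> set (vertex G)),
    rng e = \bigcup_n A n /\
    forall n, [\/ minimal_infinite_emitter (A n), minimal_sink (A n) |
                 exists2 v, A n = [set v] & sink v \/ regular v].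

Definition edge_chain : rel (edge G) := fun e f => src f \in rng e.

(* Finite paths are sequences; the empty one gets range [setT] so that the
   condition A \subseteq r(alpha) is void for the ultrapaths (A, A) of length 0. *)
Definition path_rng (s : seq (edge G)) : set (vertex G) :=
  if s is e :: s' then rng (last e s') else setT.

(* Raw data of an element of p^oo + p: [FinPath [::] A] stands for (A, A). *)
Inductive upath :=
| InfPath of nat -> edge G
| FinPath of seq (edge G) & set (vertex G).
Implicit Types y g : upath.

Definition infinite_path (x : nat -> edge G) := forall n, edge_chain (x n) (x n.+1).

Definition ultrapath (s : seq (edge G)) A :=
  [/\ sorted edge_chain s, gvertex A & A `<=` path_rng s].

Definition is_upath y :=
  match y with
  | InfPath x => infinite_path x
  | FinPath s A => ultrapath s A
  end.

Definition X_fin (s : seq (edge G)) A :=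
  ultrapath s A /\
  [\/ minimal_infinite_emitter A, minimal_sink A |
      exists2 v, A = [set v] & sink v].

Definition X_sin (s : seq (edge G)) A :=
  ultrapath s A /\ (minimal_sink A \/ exists2 v, A = [set v] & sink v).

Definition is_boundary y :=
  match y with
  | InfPath x => infinite_path x
  | FinPath s A => X_fin s A
  end.

Record boundary_space := BoundarySpace {
  bval :> upath;
  bvalP : is_boundary bval }.

(* s(g), as a set: the singleton of a vertex when |g| >= 1, and A for (A, A). *)
Definition upath_src g : set (vertex G) :=
  match g with
  | InfPath x => [set src (x 0)]
  | FinPath (e :: _) _ => [set src e]
  | FinPath [::] A => A
  end.

(* [None] exactly when |g| = 0. *)
Definition first_edge g : option (edge G) :=
  match g with
  | InfPath x => Some (x 0)
  | FinPath s _ => ohead s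
  end.

Definition concat (b : seq (edge G)) g : upath :=
  match g with
  | InfPath x => InfPath (fun n => nth (x (n - size b)) b n)
  | FinPath s A => FinPath (b ++ s) A
  end.

Definition cylinder (b : seq (edge G)) B : set boundary_space :=
  [set y | exists g,
     [/\ is_upath g, bval y = concat b g & upath_src g `<=` B]].

Definition cylinderFS (b : seq (edge G)) B (F : set (edge G))
    (S : set (vertex G)) : set boundary_space :=
  [set y | bval y = FinPath b B] `|`
  [set y | exists g e,
     [/\ is_upath g, bval y = concat b g, first_edge g = Some e &
         (emitted B `\` F) e]] `|`
  [set y | exists v,
     [/\ bval y = FinPath b [set v], X_sin b [set v] & (B `\` S) v]].

Definition basic_cylinder : set (set boundary_space) :=
  [set C | (exists b B, [/\ ultrapath b B, 1 <= size b & C = cylinder b B]) \/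
    (exists b B F S,
      [/\ X_fin b B, finite_set F /\ F `<=` emitted B,
          finite_set S /\ S `<=` B `&` sink & C = cylinderFS b B F S])].

Lemma concatA a b g : concat a (concat b g) = concat (a ++ b) g.
Proof.
case: g => [x|s A] /=; last by rewrite catA.
congr InfPath; apply/funext => n; rewrite nth_cat size_cat subnDA.
by case: ltnP => // h; [exact: set_nth_default|rewrite [LHS]nth_default].
Qed.

Lemma is_upath_suffix b g : is_upath (concat b g) -> is_upath g.
Proof.
case: g => [x|s A] /=.
  move=> h n; have := h (size b + n).
  by rewrite -addnS !nth_default ?leq_addr// !addKn.
move=> [h1 h2 h3]; split=> //.
  by move: h1; rewrite /sorted; case: b {h3} => //= e b;
     rewrite cat_path => /andP[_]; exact: path_sorted.
case: s h3 {h1} => [|e s]; first by [].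
by case: b => //= f b; rewrite last_cat.
Qed.

Lemma is_boundary_upath y : is_boundary y -> is_upath y.
Proof. by case: y => //= s A []. Qed.

Lemma upath_src_first g e : first_edge g = Some e -> upath_src g = [set src e].
Proof. by case: g => [x|[|f s] A] //= [->]. Qed.

Lemma cylinderFS_extends b B F S (y : boundary_space) : cylinderFS b B F S y ->
  exists g, bval y = concat b g.
Proof.
case=> [[->|[g [e [_ -> _ _]]]]|[v [-> _ _]]]; last 1 first.
- by exists (FinPath [::] [set v]); rewrite /= cats0.
- by exists (FinPath [::] B); rewrite /= cats0.
- by exists g.
Qed.

Lemma cylinder_extends b B (y : boundary_space) : cylinder b B y -> exists g, bval y = concat b g.
Proof. by case=> g [_ -> _]; exists g. Qed.


Lemma cylinder_strict b B e c h (z : boundary_space) :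
  B (src e) -> bval z = concat (b ++ e :: c) h -> cylinder b B z.
Proof.
move=> Be; rewrite -concatA => zE; exists (concat (e :: c) h); split=> //.
  by apply: (@is_upath_suffix b); rewrite -zE; exact/is_boundary_upath/bvalP.
by rewrite (@upath_src_first _ e) => [_ ->//|]; case: (h).
Qed.

Lemma cylinderFS_strict b B F S e c h (z : boundary_space) :
  (emitted B `\` F) e -> bval z = concat (b ++ e :: c) h ->
  cylinderFS b B F S z.
Proof.
move=> Be; rewrite -concatA => zE; left; right.
exists (concat (e :: c) h), e; split=> //; last by case: (h).
by apply: (@is_upath_suffix b); rewrite -zE; exact/is_boundary_upath/bvalP.
Qed.

Lemma cylinderFS_sub_strict s A (C : set boundary_space) :
  (forall h (z : boundary_space), bval z = concat s h -> C z) ->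
  cylinderFS s A set0 set0 `<=` C.
Proof. by move=> h z /cylinderFS_extends[g]; exact: h. Qed.

Lemma X_sin1_sink b v : X_sin b [set v] -> sink v.
Proof.
case=> _ [[_ + _ _]|[w /seteqP[/(_ v erefl) -> _] //]].
by case; exact: finite_set1.
Qed.

Lemma X_fin_sink_cylinder b v (z : boundary_space) : sink v ->
  cylinderFS b [set v] set0 set0 z -> bval z = FinPath b [set v].
Proof.
move=> sv [[//|[g [e [_ _ _ [/= esv _]]]]]|[w [-> _ [/= -> _]]]//].
by have : (src @^-1` [set v]) e by []; rewrite sv.
Qed.

Lemma basic_cylinder_fin C (y : boundary_space) s A :
  basic_cylinder C -> C y -> bval y = FinPath s A ->
  exists F S, [/\ finite_set F /\ F `<=` emitted A,
    finite_set S /\ S `<=` A `&` sink & cylinderFS s A F S `<=` C].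
Proof.
move=> bC Cy yE.
case: bC Cy => [[b [B [ub bN ->]]]|[b [B [F [S [Xb Fp Sp CE]]]]]].
- case=> g [ug yg gB].
  case: g ug yg gB => [x|[|e c] A']; rewrite yE => // ug [sE AE].
    rewrite /= -AE => AB; rewrite cats0 in sE; subst s.
    exists set0, set0; split; try by split=> //; exact: finite_set0.
    move=> z [[/= zE|[g [f [? ? fE [/= Af _]]]]]|[v [zE [? _] [/= Av _]]]].
    + exists (FinPath [::] A); rewrite /= cats0; split=> //.
      by rewrite AE.
    + by exists g; split=> //; rewrite (upath_src_first fE) => _ ->; exact: AB.
    + exists (FinPath [::] [set v]); rewrite /= cats0; split=> //.
        by split=> //; exact: gvertex_vertex.
      by move=> _ ->; exact: AB.
  move=> eB; have {}eB : B (src e) by exact: eB.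
  exists set0, set0; split; try by split=> //; exact: finite_set0.
  apply: cylinderFS_sub_strict => h z; rewrite sE; exact: cylinder_strict.
- rewrite CE => -[[/= yE'|[g [e [ug yg ge eB]]]]|[v [yv Xv vB]]].
  + by move: yE'; rewrite yE => -[-> ->]; exists F, S; split.
  + case: g ug yg ge => [x|[//|f c] A']; rewrite yE => // _ [sE _] [fe]; subst f.
    exists set0, set0; split; try by split=> //; exact: finite_set0.
    apply: cylinderFS_sub_strict => h z; rewrite sE; exact: cylinderFS_strict.
  + move: yv; rewrite yE => -[-> ->].
    exists set0, set0; split; try by split=> //; exact: finite_set0.
    move=> z /(X_fin_sink_cylinder (X_sin1_sink Xv)) zE.
    by right; exists v.
Qed.

Lemma mkseq_concat (x x' : nat -> edge G) b n :
  InfPath x = concat b (InfPath x') -> size b < n ->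
  exists c, mkseq x n = b ++ x' 0 :: c.
Proof.
move=> [->] bn; exists (mkseq (x' \o succn) (n - (size b).+1)).
apply: (@eq_from_nth _ (x' 0)) => [|i].
  by rewrite size_cat /= !size_mkseq addnS -addSn subnKC.
rewrite size_mkseq => ni; rewrite nth_mkseq// nth_cat.
case: ltnP => h; first exact: set_nth_default.
rewrite nth_default//; case E: (i - size b) => [//|k] /=.
by rewrite nth_mkseq//= ltn_subRL addSn -addnS -E subnKC.
Qed.

Lemma basic_cylinder_inf C (y : boundary_space) x :
  basic_cylinder C -> C y -> bval y = InfPath x ->
  exists m, forall n B, m < n -> cylinder (mkseq x n) B `<=` C.
Proof.
move=> bC Cy yE.
case: bC Cy => [[b [B [_ _ ->]]]|[b [B [F [S [_ _ _ ->]]]]]].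
- case=> -[x'|s A] [_ + gB]; rewrite yE // => xE; exists (size b) => n B' bn.
  have [c ->] := mkseq_concat xE bn.
  by move=> z /cylinder_extends[h]; apply: cylinder_strict; exact: gB.
- case=> [[/=|[[x'|s A] [e [_ + + eB]]]]|[v []]]; rewrite yE//= => xE [eE].
  exists (size b) => n B' bn.
  have [c ->] := mkseq_concat xE bn.
  by move=> z /cylinder_extends[h]; apply: cylinderFS_strict; rewrite eE.
Qed.

Lemma cylinder_mkseq (y : boundary_space) x n : bval y = InfPath x ->
  basic_cylinder (cylinder (mkseq x n.+1) (path_rng (mkseq x n.+1))) /\
  cylinder (mkseq x n.+1) (path_rng (mkseq x n.+1)) y.
Proof.
move=> yE; have xP : infinite_path x by have := bvalP y; rewrite yE.
have rE : path_rng (mkseq x n.+1) = rng (x n).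
  rewrite /= (last_nth (x 0)) size_map size_iota.
  exact: (congr1 rng (nth_mkseq (x 0) x (ltnSn n))).
split.
  left; exists (mkseq x n.+1), (path_rng (mkseq x n.+1)); split=> //.
  split=> //; last by rewrite rE; exact: gvertex_rng.
  apply/(sortedP (x 0)) => i; rewrite size_mkseq => ni.
  by rewrite !nth_mkseq ?(ltnW ni)//; exact: xP.
exists (InfPath (fun k => x (n.+1 + k))); split.
- by move=> k /=; rewrite addnS; exact: xP.
- rewrite yE /concat; congr InfPath; apply/funext => k; rewrite size_mkseq.
  case: (ltnP k n.+1) => kn; first by rewrite nth_mkseq.
  by rewrite nth_default ?size_mkseq// subnKC.
- by rewrite rE /= addn0 => _ ->; have := xP n; rewrite /edge_chain inE.
Qed.

Lemma cylinderFS_refl (y : boundary_space) b B F S : bval y = FinPath b B ->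
  cylinderFS b B F S y.
Proof. by move=> ?; left; left. Qed.

Lemma cylinderFS_sub b B F F' S S' : F `<=` F' -> S `<=` S' ->
  cylinderFS b B F' S' `<=` cylinderFS b B F S.
Proof.
move=> FF SS y [[/= yE|[g [e [? ? ? [? nF]]]]]|[v [? ? [? nS]]]].
- by left; left.
- by left; right; exists g, e; split=> //; split=> // /FF.
- by right; exists v; split=> //; split=> // /SS.
Qed.

Lemma basic_cylinder_cover : \bigcup_(C in basic_cylinder) C = setT.
Proof.
rewrite -subTset => y _; case yE : (bval y) => [x|b B].
  by have [? ?] := cylinder_mkseq 0 yE; eexists; eauto.
exists (cylinderFS b B set0 set0); last exact: cylinderFS_refl.
right; exists b, B, set0, set0; split=> //; try by split.
by have := bvalP y; rewrite yE.
Qed.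

Lemma basic_cylinder_join C D (y : boundary_space) : basic_cylinder C -> basic_cylinder D ->
  C y -> D y -> exists E, [/\ basic_cylinder E, E y & E `<=` C `&` D].
Proof.
move=> bC bD Cy Dy; case yE : (bval y) => [x|b B].
  have [m mP] := basic_cylinder_inf bC Cy yE.
  have [n nP] := basic_cylinder_inf bD Dy yE.
  have [? ?] := cylinder_mkseq (maxn m n) yE.
  eexists; split; eauto => z zE; split.
    by apply: mP zE; rewrite ltnS leq_maxl.
  by apply: nP zE; rewrite ltnS leq_maxr.
have [F [S [[fF FB] [fS SB] FS]]] := basic_cylinder_fin bC Cy yE.
have [F' [S' [[fF' FB'] [fS' SB'] FS']]] := basic_cylinder_fin bD Dy yE.
exists (cylinderFS b B (F `|` F') (S `|` S')); split.
- right; exists b, B, (F `|` F'), (S `|` S'); split=> //.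
  + by have := bvalP y; rewrite yE.
  + by split; [rewrite finite_setU|rewrite subUset].
  + by split; [rewrite finite_setU|rewrite subUset].
- exact: cylinderFS_refl.
- move=> z zE; split; [apply: FS|apply: FS'];
    by apply: cylinderFS_sub zE => ? ?; (by left) || by right.
Qed.

HB.instance Definition _ := gen_eqMixin boundary_space.
HB.instance Definition _ := gen_choiceMixin boundary_space.

HB.instance Definition _ := isBaseTopological.Build boundary_space
  basic_cylinder_cover basic_cylinder_join.

Lemma basis_basic_cylinder : basis basic_cylinder.
Proof.
have op C : basic_cylinder C -> open C.
  move=> bC; exists [set C]; first by move=> _ ->.
  by rewrite bigcup_set1.
split; first exact: op.
move=> y U; rewrite nbhsE => -[V [[D' D'b <-] [C D'C Cy]] VU].
by exists C; [split=> //; exact: D'b|apply: subset_trans VU => z; exists C].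
Qed.

End Ultragraph.

(* Main.v *)
Require Import Defs.
From mathcomp Require Import all_boot finmap.
From mathcomp Require Import boolp classical_sets functions cardinality.
From mathcomp Require Import filter topology_structure compact.

Set Implicit Arguments.
Unset Strict Implicit.
Unset Printing Implicit Defensive.

Local Open Scope classical_set_scope.

(** Compactness is tested on ultrafilters: an ultrafilter [U] containing one of
the cylinders must converge to a point of that cylinder.  The limit is found by
reading off its edges one at a time.

Write [extensions b] for the set of boundary paths that extend the finite path
[b].  Suppose that [U] contains a cylinder with base path [b].

- If the cylinder is [cylinderFS b B F S], then ([ultra_cylinderFS]) either [U]
  contains [extensions (b ++ [:: e])] for an allowed edge [e], and one more edge
  of the limit is known; or [U] contains the singleton of a point
  [(b, {v})], and converges to it; or neither happens, and then removing
  finitely many edges and sinks from the cylinder never leaves [U], which says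
  exactly that [U] converges to [(b, B)].

- If the cylinder is [cylinder b B] with [b] nonempty, Condition (RFUM2) is
  used.  It gives a decomposition of the range of [b], which is first turned
  into one of the subset [B] itself ([pieces_of_subset]): [B] is a finite union
  of minimal infinite emitters, minimal sinks, and singletons of sinks or of
  regular vertices.  The point is that every end [C] of a boundary ultrapath
  [(b, C)] with [C] inside [B] then is one of the pieces, or a sink in one of
  them ([minimal_large_piece]).  Hence [cylinder b B] is covered by finitely
  many sets [cylinderFS b A set0 set0], for the pieces [A] other than regular
  vertices, and [extensions (b ++ [:: e])], for the edges [e] that start in a
  regular piece.  One of them lies in [U]: either the previous item applies, or
  one more edge is known ([ultra_cylinder]).

If [U] never converges along the way, this produces an infinite path [x] all of
whose initial segments [c] satisfy [U (extensions c)].  These sets form a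
neighbourhood basis of [x], so [U] converges to [x] after all
([ultra_extensions]).  Every set met in the process is contained in the cylinder
at the start, so the limit belongs to that cylinder. *)

(** * Ultrafilters *)

Lemma ultra_setU {T : Type} {U : set_system T} {UU : UltraFilter U}
    (A B C : set T) :
  U A -> A `<=` B `|` C -> U B \/ U C.
Proof.
move=> UA ABC; have [|UnB] := in_ultra_setVsetC B UU; [by left|right].
by apply: filterS (filterI UA UnB) => x [/ABC[]].
Qed.

Lemma ultra_bigcup {T : Type} {I : choiceType} {U : set_system T}
    {UU : UltraFilter U} (D : set I) (f : I -> set T) :
  finite_set D -> U (\bigcup_(i in D) f i) -> exists2 i, D i & U (f i).
Proof.
move=> finD UD; apply: contrapT => noi.
have UnD : U (\bigcap_(i in [set` fset_set D]) ~` f i).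
  apply: filter_bigI => i; rewrite in_fset_set// inE => Di.
  have [Ufi|//] := in_ultra_setVsetC (f i) UU.
  by exfalso; apply: noi; exists i.
have [x [[i Di fx]]] := filter_ex (filterI UD UnD).
by move/(_ i); apply=> //=; rewrite in_fset_set// inE.
Qed.

(** * Minimal generalized vertices *)

Section Pieces.
Context {G : ultragraph}.
Implicit Types (A B C : set (vertex G)) (P : set (set (vertex G))).

(** Minimal infinite emitters and minimal sinks are the minimal generalized
vertices for this one notion of size ([minimal_largeP]), which allows a common
treatment of the two. What makes it useful is that it passes from a finite union
to one of its members. *)
Definition large A := infinite_set A \/ infinite_set (emitted A).

Definition minimal_large A :=
  [/\ gvertex A, large A & forall B, gvertex B -> B `<` A -> ~ large B].

(** The possible ends [A] of the finite boundary ultrapaths [(b, A)]. *)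
Definition terminal A :=
  [\/ minimal_infinite_emitter A, minimal_sink A |
      exists2 v, A = [set v] & sink v].

(** The sets allowed by Condition (RFUM2) in the decomposition of a range. *)
Definition piece A := terminal A \/ exists2 v, A = [set v] & regular v.

Lemma emittedS A B : A `<=` B -> emitted A `<=` emitted B.
Proof. by move=> AB e; exact: AB. Qed.

Lemma not_largeP A : ~ large A <-> finite_set A /\ finite_set (emitted A).
Proof.
split=> [nA|[? ?] []//].
by split; apply: contrapT => h; apply: nA; [left|right].
Qed.

Lemma largeS A B : A `<=` B -> large A -> large B.
Proof.
move=> AB lA; apply: contrapT => /not_largeP[fB feB].
case: lA; apply; first exact: sub_finite_set AB fB.
exact: sub_finite_set (emittedS AB) feB.
Qed.

Lemma large_nonempty A : large A -> A !=set0.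
Proof.
move=> lA; apply/set0P/eqP => A0; case: lA; rewrite A0; apply.
  exact: finite_set0.
by apply: (@sub_finite_set _ _ set0) => // e [].
Qed.

Lemma large_bigcup P A : finite_set P -> large A ->
  A `<=` \bigcup_(B in P) B -> exists2 B, P B & large (A `&` B).
Proof.
move=> finP lA AP; apply: contrapT => noB.
have small B : P B -> finite_set (A `&` B) /\ finite_set (emitted (A `&` B)).
  by move=> PB; apply/not_largeP => lB; apply: noB; exists B.
case: lA; apply.
- apply: (@sub_finite_set _ _ (\bigcup_(B in P) (A `&` B))).
    by move=> v Av; have [B PB Bv] := AP v Av; exists B.
  by apply: bigcup_finite => // B /small[].
- apply: (@sub_finite_set _ _ (\bigcup_(B in P) emitted (A `&` B))).
    by move=> e Ae; have [B PB Be] := AP _ Ae; exists B.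
  by apply: bigcup_finite => // B /small[].
Qed.

Lemma minimal_largeP A :
  minimal_large A <-> minimal_infinite_emitter A \/ minimal_sink A.
Proof.
split=> [[gA lA minA]|[[[gA eA] minA]|[gA iA feA minA]]].
- have [feA|ieA] := pselect (finite_set (emitted A)).
    right; split=> //; first by case: lA.
    by move=> B gB BA iB; apply: (minA B gB BA); left.
  left; split=> // B gB BA [[_ ?]|[_ ?]];
    by apply: (minA B gB BA); (by left) || by right.
- split=> //; first by right.
  move=> B gB BA; have [feB|ieB] := pselect (finite_set (emitted B)).
    by case=> // iB; apply: (minA B gB BA); right.
  by move=> _; apply: (minA B gB BA); left.
- split=> //; first by left.
  move=> B gB BA; case; first exact: minA.
  by apply; apply: sub_finite_set feA; apply: emittedS; exact: properW.
Qed.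

Lemma small_vertex {v} : ~ large [set v] <-> sink v \/ regular v.
Proof.
rewrite not_largeP; split=> [[_ fv]|sr].
  have [v0|v0] := pselect (emitted [set v] !=set0); first by right; split.
  by left; apply/eqP; apply: contrapT => /negP/set0P.
split; first exact: finite_set1.
case: sr => [sv|[]//].
rewrite [emitted _](sv : src @^-1` [set v] = set0); exact: finite_set0.
Qed.

(** Condition (RFUM2) is thus about decompositions into minimal large sets and
vertices that are not large. *)
Lemma pieceP A : piece A <->
  minimal_large A \/ exists2 v, A = [set v] & ~ large [set v].
Proof.
rewrite minimal_largeP; split.
- case=> [[?|?|[v ? ?]]|[v ? ?]]; [by left; left|by left; right|right|right];
    by exists v => //; apply/small_vertex; (by left) || by right.
- case=> [[?|?]|[v ? /small_vertex[]?]].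
  + by left; apply: Or31.
  + by left; apply: Or32.
  + by left; apply: Or33; exists v.
  + by right; exists v.
Qed.

Lemma piece_meet A B : piece A -> gvertex B -> ~ A `<=` B -> ~ large (B `&` A).
Proof.
move=> /pieceP[[gA lA minA]|[v -> sv]] gB nAB lBA.
  apply: (minA (B `&` A) _ _ lBA).
    by apply: gvertex_inter => //; exact: large_nonempty.
  by split=> [v []//|AB]; apply: nAB => v /AB[].
by apply: sv; exact: largeS lBA.
Qed.

(** Decompositions are inherited by the generalized vertices inside a range: a
piece of [rng e] that is not contained in [B] meets [B] in a set that is not
large, so that this intersection splits into finitely many vertices, none of
which is an infinite emitter. *)
Lemma pieces_of_subset e B : RFUM2 G -> gvertex B -> B `<=` rng e ->
  exists P, [/\ finite_set P, forall A, P A -> piece A &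
    B = \bigcup_(A in P) A].
Proof.
move=> /(_ e)[k [A [rE Apiece]]] gB Be.
have pA i : piece (A i).
  case: (Apiece i) => [?|?|[v ? [?|?]]].
  - by left; apply: Or31.
  - by left; apply: Or32.
  - by left; apply: Or33; exists v.
  - by right; exists v.
(* the vertices of B that are covered by a piece not contained in B *)
pose W := \bigcup_(i in [set i | ~ A i `<=` B]) (B `&` A i).
have smallBA i : ~ A i `<=` B -> ~ large (B `&` A i) by exact: piece_meet.
exists ((A @` [set i | A i `<=` B]) `|` (set1 @` W)); split.
- rewrite finite_setU; split; apply: finite_image.
    exact: finite_finset.
  apply: bigcup_finite => [|i /smallBA/not_largeP[]//].
  exact: finite_finset.
- move=> _ [[i _ <-]|[v [i nAB [Bv Av]] <-]]; first exact: pA.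
  apply/pieceP; right; exists v => // lv; apply: (smallBA i nAB).
  by apply: largeS lv => _ ->.
- apply/seteqP; split=> [v Bv|v [C]].
    have := Be v Bv; rewrite rE => -[i _ Av].
    have [AB|nAB] := pselect (A i `<=` B).
      by exists (A i) => //; left; exists i.
    by exists [set v] => //; right; exists v => //; exists i.
  by case=> [[i AB <-]|[w [i _ [Bw _]] <-]]; [exact: AB|move->].
Qed.

(** Since [C] is large, so is its intersection with some piece; two minimal
large sets with a large intersection are equal. *)
Lemma minimal_large_piece P C : finite_set P -> (forall A, P A -> piece A) ->
  minimal_large C -> C `<=` \bigcup_(A in P) A -> P C.
Proof.
move=> finP pP [gC lC minC] CP.
have [A PA lCA] := large_bigcup finP lC CP.
have [[gA lA minA]|[v AE sv]] := (pieceP A).1 (pP A PA); last first.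
  by exfalso; apply: sv; rewrite -AE; apply: largeS lCA => w [].
have CA : C `<=` A.
  apply: contrapT => nCA; apply: (minC (C `&` A) _ _ lCA).
    by apply: gvertex_inter => //; exact: large_nonempty.
  by split=> [v []//|CCA]; apply: nCA => v /CCA[].
suff -> : C = A by [].
apply/seteqP; split=> //; apply: contrapT => nAC.
by apply: (minA C gC _ lC); split.
Qed.

End Pieces.

(** * Cylinders *)

Section Cylinders.
Context {G : ultragraph}.
Local Notation X := (boundary_space G).
Implicit Types (A B : set (vertex G)) (b : seq (edge G)).

(** For nonempty [b] this is the cylinder of [(b, r(b))], see [extensionsE]; the
present form does not mention ranges and composes well with concatenation. *)
Definition extensions b : set X := [set y | exists g, bval y = concat b g].

Lemma upath_behead (g : upath G) e : first_edge g = Some e ->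
  exists h, g = concat [:: e] h.
Proof.
case: g => [x [<-]|[//|f s] A [<-]]; last by exists (FinPath s A).
exists (InfPath (x \o succn)); congr InfPath; apply/funext => -[|n] //=.
by rewrite nth_nil subn1.
Qed.

Lemma first_edge_extensions {b} {g : upath G} {e} {y : X} :
  bval y = concat b g -> first_edge g = Some e -> extensions (b ++ [:: e]) y.
Proof.
by move=> yE /upath_behead[h gE]; exists h; rewrite yE gE concatA.
Qed.

Lemma extensions_cylinder b B e : B (src e) ->
  extensions (b ++ [:: e]) `<=` cylinder b B.
Proof. by move=> Be y [g]; exact: cylinder_strict. Qed.

Lemma extensions_cylinderFS b B F S e : (emitted B `\` F) e ->
  extensions (b ++ [:: e]) `<=` cylinderFS b B F S.
Proof. by move=> Be y [g]; exact: cylinderFS_strict. Qed.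

Lemma extended_ultrapath b (y : X) : 1 <= size b -> extensions b y ->
  ultrapath b (path_rng b).
Proof.
move=> b1 [g yE]; split=> //.
  2: by case: b b1 {yE} => // *; exact: gvertex_rng.
have := is_boundary_upath (bvalP y); rewrite yE; case: g {yE} => [x xP|s A].
  apply/(sortedP (x 0)) => i ib; have := xP i.
  rewrite (set_nth_default (x 0) _ ib).
  by rewrite (set_nth_default (x 0) _ (ltnW ib)).
by case: b b1 => //= e b _ []; rewrite /= cat_path => /andP[].
Qed.

Lemma concat_src_sub b (g : upath G) : 1 <= size b ->
  is_upath (concat b g) -> upath_src g `<=` path_rng b.
Proof.
case: b => // e b _; case: g => [x|[|f s] A] /=.
- move=> /(_ (size b)); rewrite /edge_chain inE [X in src X]nth_default//.
  by rewrite subnn (set_nth_default e)// -last_nth => h _ ->.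
- by move=> [_ _]; rewrite cats0.
- move=> [+ _ _]; rewrite /= cat_path /= => /and3P[_ + _].
  by rewrite /edge_chain inE => h _ ->.
Qed.

Lemma extensionsE b : 1 <= size b -> extensions b = cylinder b (path_rng b).
Proof.
move=> b1; apply/seteqP; split=> [y [g yE]|y].
  2: by move=> /cylinder_extends[g]; exists g.
have yu := is_boundary_upath (bvalP y); rewrite yE in yu.
exists g; split=> //; first exact: is_upath_suffix yu.
exact: concat_src_sub.
Qed.

Lemma cylinderFS_cylinder b A B : A `<=` B -> X_fin b A ->
  cylinderFS b A set0 set0 `<=` cylinder b B.
Proof.
move=> AB [[_ gA _] _] y [[/= yE|[g [e [? yE ge [Ae _]]]]]|[v [yE _ [Av _]]]].
- by exists (FinPath [::] A); rewrite /= cats0.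
- apply: (extensions_cylinder (AB _ Ae)); exact: first_edge_extensions ge.
- exists (FinPath [::] [set v]); rewrite /= cats0; split=> //.
    by split=> //; exact: gvertex_vertex.
  by move=> _ ->; exact: AB.
Qed.

(** * Limits of ultrafilters *)

Lemma cvg_basic_cylinder (U : set_system X) {FU : Filter U} (p : X) :
  (forall C, basic_cylinder C -> C p -> U C) -> U --> p.
Proof.
move=> UC V /(basis_basic_cylinder G).2 [C [bC Cp] CV].
by apply: filterS CV _; exact: UC.
Qed.

Section Ultra.
Variables (U : set_system X) (UU : UltraFilter U).

Lemma ultra_cvg_fin b B (p : X) : bval p = FinPath b B ->
  (forall F S, finite_set F -> finite_set S -> U (cylinderFS b B F S)) ->
  U --> p.
Proof.
move=> pE UC; apply: cvg_basic_cylinder => C bC Cp.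
have [F [S [[fF _] [fS _] FSC]]] := basic_cylinder_fin bC Cp pE.
by apply: filterS FSC _; exact: UC.
Qed.

Lemma ultra_cvg_inf (p : X) (x : nat -> edge G) b :
  bval p = concat b (InfPath x) ->
  (forall n, U (extensions (b ++ mkseq x n))) -> U --> p.
Proof.
move=> pE Ux; apply: cvg_basic_cylinder => C bC Cp.
have [m mC] := basic_cylinder_inf bC Cp pE.
have := Ux m.+1; set c := b ++ _.
have -> : c = mkseq (fun n => nth (x (n - size b)) b n) (size c).
  apply: (@eq_from_nth _ (x 0)); rewrite ?size_mkseq// => i ic.
  rewrite nth_mkseq// nth_cat; case: ltnP => ib; first exact: set_nth_default.
  rewrite [RHS]nth_default// nth_mkseq// ltn_subLR//.
  by rewrite size_cat size_mkseq in ic.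
have mc : m < size c by rewrite size_cat size_mkseq ltn_addl.
rewrite extensionsE ?size_mkseq ?(leq_trans _ mc)//.
by apply: filterS; exact: mC.
Qed.

(** If neither an edge nor a sink can be read off, none of the sets removed in passing
to a smaller basic neighbourhood of [(b, B)] belongs to [U]. *)
Lemma ultra_cylinderFS b B F S : X_fin b B -> U (cylinderFS b B F S) ->
  (exists2 p, cylinderFS b B F S p & U --> p) \/
  exists2 e, (emitted B `\` F) e & U (extensions (b ++ [:: e])).
Proof.
move=> bB UFS.
have [?|noe] :=
    pselect (exists2 e, (emitted B `\` F) e & U (extensions (b ++ [:: e]))).
  by right.
left.
pose single v : set X := [set y | bval y = FinPath b [set v]].
have [[v [Xv Bv Uv]]|nov] := pselect
    (exists v, [/\ X_sin b [set v], (B `\` S) v & U (single v)]).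
  have [p pE] := filter_ex Uv.
  exists p; first by right; exists v.
  apply: (ultra_cvg_fin pE) => F' S' _ _; apply: filterS Uv => y.
  exact: cylinderFS_refl.
exists (BoundarySpace (bval := FinPath b B) bB); first exact: cylinderFS_refl.
apply: ultra_cvg_fin => // F' S' fF' fS'.
have : cylinderFS b B F S `<=` cylinderFS b B F' S' `|`
    ((\bigcup_(e in F' `&` (emitted B `\` F)) extensions (b ++ [:: e])) `|`
     (\bigcup_(v in S' `&` [set v | X_sin b [set v] /\ (B `\` S) v]) single v)).
  move=> y [[/= yE|[g [e [ug yE ge eB]]]]|[v [yE Xv vB]]].
  - by left; exact: cylinderFS_refl.
  - have ye := first_edge_extensions yE ge.
    have [F'e|nF'e] := pselect (F' e); first by right; left; exists e.
    by left; apply: extensions_cylinderFS ye; split=> //; case: eB.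
  - have [S'v|nS'v] := pselect (S' v); first by right; right; exists v.
    by left; right; exists v; split=> //; split=> //; case: vB.
move=> /(ultra_setU UFS)[//|Ue].
have [Uee|Uv] := ultra_setU Ue (fun y => id).
- have [|e [_ Be] Ue'] := ultra_bigcup _ Uee.
    exact: sub_finite_set (@subIsetl _ _ _) fF'.
  by exfalso; apply: noe; exists e.
- have [|v [_ [Xv Bv]] Uv'] := ultra_bigcup _ Uv.
    exact: sub_finite_set (@subIsetl _ _ _) fS'.
  by exfalso; apply: nov; exists v.
Qed.

Hypothesis rfum : RFUM2 G.

(** Edges starting in a piece that is not terminal, that is, in a regular
vertex, are finite in number and are treated one by one; each terminal piece is
handed over to [ultra_cylinderFS]. *)
Lemma ultra_cylinder b B : ultrapath b B -> 1 <= size b -> U (cylinder b B) ->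
  (exists2 p, cylinder b B p & U --> p) \/
  exists2 e, B (src e) & U (extensions (b ++ [:: e])).
Proof.
move=> [sb gB Bb] b1 UB.
have [P [finP pP BE]] : exists P, [/\ finite_set P, forall A, P A -> piece A &
    B = \bigcup_(A in P) A].
  by case: b b1 Bb {sb UB} => // e b _ /=; exact: pieces_of_subset.
have PB A : P A -> A `<=` B by move=> PA v Av; rewrite BE; exists A.
have PX A : P A -> terminal A -> X_fin b A.
  move=> PA tA; split=> //; split=> //; last exact: subset_trans (PB A PA) Bb.
  by case: (tA) => [[[]]//|[]//|[v -> _]]; exact: gvertex_vertex.
pose E := \bigcup_(A in P `&` [set A | ~ terminal A]) emitted A.
have finE : finite_set E.
  apply: bigcup_finite; first exact: finite_setIl.
  by move=> A [/pP[//|[v -> [_]]]].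
have : cylinder b B `<=`
    (\bigcup_(A in P `&` terminal) cylinderFS b A set0 set0) `|`
    (\bigcup_(e in E) extensions (b ++ [:: e])).
  move=> y [g [ug yE gB']]; case ge : (first_edge g) => [e|].
    have ye := first_edge_extensions yE ge.
    rewrite (upath_src_first ge) in gB'.
    have := gB' _ erefl; rewrite BE => -[A PA Ae].
    have [tA|ntA] := pselect (terminal A).
    2: by right; exists e => //; exists A.
    by left; exists A => //; apply: extensions_cylinderFS ye; split.
  case: g ug yE gB' ge => [//|[|//] C] _ yE /= CB _; rewrite /= cats0 in yE.
  have := bvalP y; rewrite yE => -[uC tC]; left.
  have large_case : minimal_large C ->
      (\bigcup_(A in P `&` terminal) cylinderFS b A set0 set0) y.
    move=> mC; exists C; last exact: cylinderFS_refl.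
    by split=> //; apply: (minimal_large_piece finP pP mC); rewrite -BE.
  case: (tC) => [mC|mC|[v vE sv]].
  - by apply: large_case; apply/minimal_largeP; left.
  - by apply: large_case; apply/minimal_largeP; right.
  - rewrite vE in yE uC CB; have := CB v erefl; rewrite BE => -[A PA Av].
    (* the piece of the sink v is not the singleton of a regular vertex *)
    have tA : terminal A.
      case: (pP A PA) => // -[w AE [[e /= ew] _]].
      move: Av; rewrite AE => /= vw.
      by have : set0 e by rewrite -sv vw.
    exists A => //; right; exists v; split=> //.
      by split=> //; right; exists v.
    by split.
move=> /(ultra_setU UB)[UA|Ue].
- have [|A [PA tA] UA'] := ultra_bigcup _ UA; first exact: finite_setIl.
  have [[p pA Up]|[e [Ae _] Ue]] := ultra_cylinderFS (PX A PA tA) UA'.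
    by left; exists p => //; apply: cylinderFS_cylinder pA => //;
       [exact: PB|exact: PX].
  by right; exists e => //; exact: PB Ae.
- have [e [A [PA _] Ae] Ue'] := ultra_bigcup finE Ue.
  by right; exists e => //; exact: PB Ae.
Qed.

(** Without a limit in [extensions b], the previous step can be repeated
forever; the edges that it yields form an infinite path, and this is a limit. *)
Lemma ultra_extensions b : 1 <= size b -> U (extensions b) ->
  exists2 p, extensions b p & U --> p.
Proof.
move=> b1 Ub; apply: contrapT => nop.
pose live c := U (extensions (b ++ c)).
have step c : live c -> exists e, live (c ++ [:: e]).
  move=> Uc; have bc1 : 1 <= size (b ++ c) by rewrite size_cat ltn_addr.
  have [y yc] := filter_ex Uc.
  have := Uc; rewrite /live extensionsE//.
  move=> /(ultra_cylinder (extended_ultrapath bc1 yc) bc1)[[p pc Up]|[e _ Ue]].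
    exfalso; apply: nop; exists p => //.
    by move: pc; rewrite -extensionsE// => -[g pE];
       exists (concat c g); rewrite concatA.
  by exists e; rewrite /live catA.
(* an edge serving as the default value of the choice below *)
have [e0 _] : exists e, live ([::] ++ [:: e]).
  by apply: step; rewrite /live cats0.
pose next c := xget e0 [set e | live (c ++ [:: e])].
pose extend c := rcons c (next c).
pose x n := next (iter n extend [::]).
have xE n : iter n extend [::] = mkseq x n.
  by elim: n => // n IH; rewrite mkseqS -IH.
have Ux n : U (extensions (b ++ mkseq x n)).
  elim: n => [|n IH]; first by rewrite cats0.
  rewrite mkseqS -cats1 /x xE.
  exact: (xgetPex e0 (step _ IH)).
have xP : infinite_path (fun n => nth (x (n - size b)) b n).
  move=> n; have [y yx] := filter_ex (Ux n.+2).
  have [|+ _ _] := extended_ultrapath _ yx.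
    by rewrite size_cat ltn_addr.
  move=> /(sortedP (x 0))/(_ n).
  rewrite size_cat size_mkseq !addnS ltnS ltnS leq_addl => /(_ isT).
  have E i : i < n.+2 ->
      nth (x 0) (b ++ mkseq x n.+2) i = nth (x (i - size b)) b i.
    move=> ilt; rewrite nth_cat; case: ltnP => ib; first exact: set_nth_default.
    by rewrite [RHS]nth_default// nth_mkseq// (leq_ltn_trans (leq_subr _ _)).
  by rewrite !E.
apply: nop; exists (BoundarySpace (bval := concat b (InfPath x)) xP).
  by exists (InfPath x).
exact: ultra_cvg_inf Ux.
Qed.

End Ultra.
End Cylinders.

Theorem proposition3p22 (G : ultragraph) :
  RFUM2 G ->
  (forall (b : seq (edge G)) (B : set (vertex G)),
     ultrapath b B -> 1 <= size b -> compact (cylinder b B)) /\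
  (forall (b : seq (edge G)) (B : set (vertex G))
          (F : set (edge G)) (S : set (vertex G)),
     X_fin b B -> finite_set F -> F `<=` emitted B ->
     finite_set S -> S `<=` B `&` @sink G ->
     compact (cylinderFS b B F S)).
Proof.
move=> rfum; split=> [b B bB b1|b B F S bB _ _ _ _];
  rewrite compact_ultra => U UU UC.
- have [[p Bp Up]|[e Be Ue]] := ultra_cylinder UU rfum bB b1 UC.
    by exists p.
  have [|p pe Up] := ultra_extensions UU rfum _ Ue.
    by rewrite size_cat addn1.
  by exists p; split=> //; exact: extensions_cylinder pe.
- have [[p Bp Up]|[e Be Ue]] := ultra_cylinderFS UU bB UC.
    by exists p.
  have [|p pe Up] := ultra_extensions UU rfum _ Ue.
    by rewrite size_cat addn1.
  by exists p; split=> //; exact: extensions_cylinderFS pe.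
Qed.
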